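(* Let $m\ge 4$ and $h\ge 0$, and let $(G,D)$ be a finite $3$-transposition group of type $2^{\bullet 2h}{:}3^{\bullet 1}{:}\operatorname{Sym}(m)$. Then the diagram of $(G,D)$ has size $n=3\cdot 2^{2h-1}m(m-1)$ and spectrum $$((\,4^{h}(6m-10);\ [4^h(3m-10)]^{m-1},\ [-4^{h+1}]^{m(m-3)/2},\ [-4^h]^{m(m-1)},\ [0]^{\star}\,)).$$
   Context: A $3$-transposition group $(G,D)$ is a group $G$ generated by a conjugacy class $D$ of elements of order $2$ such that $|de|\in\{1,2,3\}$ for all $d,e\in D$. Its diagram is the graph with vertex set $D$ in which $d$ and $e$ are adjacent iff $|de|=3$; its size is $n=|D|$. The spectrum is that of the $(0,1)$-adjacency matrix, written $((k;\dots,[r]^c,\dots))$: first the degree $k$ of the (regular) diagram, counted once, then the remaining eigenvalues, $[r]^c$ meaning $r$ with multiplicity $c$; if listed values coincide, their multiplicities are added, and $[r]^\star$ means that $r$ has whatever further multiplicity (possibly zero) is required for the total multiplicity to be $n$. For a prime $p\in\{2,3\}$ and a $3$-transposition group $(H,E)$, $(G,D)$ has type $p^{\bullet j}{:}H$ if $G$ has a normal $p$-subgroup $N$ with $|D\cap dN|=p^j$ for all $d\in D$ and $(G/N,DN/N)\cong(H,E)$. Type $2^{\bullet 2h}{:}3^{\bullet 1}{:}\operatorname{Sym}(m)$ means type $2^{\bullet 2h}{:}H$ with $(H,E)$ of type $3^{\bullet 1}{:}\operatorname{Sym}(m)$, where $\operatorname{Sym}(m)$ is taken with its class of transpositions. (The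 diagram depends only on these data; whether the extensions split plays no role.) *)

(* Defs.v *)
From HB Require Import structures.
From mathcomp Require Import all_boot all_order all_algebra all_fingroup.
From mathcomp Require Import all_solvable all_field.

Set Implicit Arguments.
Unset Strict Implicit.
Unset Printing Implicit Defensive.

Import Order.TTheory GRing.Theory Num.Theory GroupScope.
Local Open Scope group_scope.

Definition three_transposition_group (gT : finGroupType)
    (G : {group gT}) (D : {set gT}) : Prop :=
  [/\ <<D>> = G,
      D \in classes G,
      {in D, forall d, #[d] = 2%N}
    & {in D &, forall d e, #[d * e] \in [:: 1%N; 2%N; 3%N]}].

Definition pair_isog (gT hT : finGroupType) (G : {group gT}) (D : {set gT})
    (H : {group hT}) (E : {set hT}) : Prop :=
  exists f : {morphism G >-> hT}, isom G H f /\ f @* D = E.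

(* Type p^{\bullet j}:H.  Every d in D normalises N, so that D / N is the set
   of all cosets dN, that is, DN/N. *)
Definition has_ext_type (p j : nat) (gT hT : finGroupType)
    (G : {group gT}) (D : {set gT}) (H : {group hT}) (E : {set hT}) : Prop :=
  exists N : {group gT},
    [/\ N <| G,
        p.-group N,
        {in D, forall d, #|D :&: (d *: N)| = (p ^ j)%N}
      & pair_isog (G / N)%G (D / N) H E].

Definition transpositions (m : nat) : {set 'S_m} :=
  [set tperm x y | x in 'I_m, y in 'I_m & x != y].

Definition diagram (gT : finGroupType) : rel gT :=
  fun d e => #[d * e] == 3%N.

Definition regular_graph (T : finType) (V : {set T}) (adj : rel T)
    (k : nat) : Prop :=
  {in V, forall x, #|[set y in V | adj x y]| = k}.

Local Open Scope ring_scope.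

Definition adjacency_mx (T : finType) (V : {set T}) (adj : rel T) :
    'M[algC]_#|V| :=
  \matrix_(i, j) (adj (enum_val i) (enum_val j))%:R.

(* ((k; s, [r]^star)): the list s contains the pairs (value, multiplicity), and
   the c roots r bring the total multiplicity up to the number of vertices.
   Multiplicities of repeated values add up in the product. *)
Definition has_spectrum (T : finType) (V : {set T}) (adj : rel T)
    (k : nat) (s : seq (algC * nat)) (r : algC) : Prop :=
  regular_graph V adj k /\
  exists c : nat,
    (1 + \sum_(xc <- s) xc.2 + c = #|V|)%N /\
    char_poly (adjacency_mx V adj) =
      ('X - (k%:R)%:P) * (\prod_(xc <- s) ('X - (xc.1)%:P) ^+ xc.2)
        * ('X - r%:P) ^+ c.

(* Main.v *)
Require Import Defs.
From HB Require Import structures.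
From mathcomp Require Import all_boot all_order all_algebra all_fingroup.
From mathcomp Require Import all_solvable all_field.
From mathcomp Require Import zify ring.

Set Implicit Arguments.
Unset Strict Implicit.
Unset Printing Implicit Defensive.

Import Order.TTheory GRing.Theory Num.Theory.
Local Open Scope ring_scope.

(* Two elements of D in distinct cosets of the normal p-subgroup N are adjacent
   exactly when their images are, whereas elements of one coset are pairwise
   nonadjacent for p = 2 and pairwise adjacent for p = 3.  So the diagram of G
   is a blow-up of that of H, the diagram of H with loops added is a blow-up of
   the triangular graph T(m) with loops added, and A(T(m)) + 2 = B^T B for the
   point-transposition incidence matrix B, with B B^T = J + (m - 2).  All the
   spectra follow from X^b char(PQ) = X^a char(QP) for P of size a x b and Q of
   size b x a. *)

(** * Characteristic polynomials and spectra of matrices *)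

Section Spectrum.
Variable F : fieldType.

(** The matrix with blocks X, A, B, 1 is multiplied by a block triangular matrix on either side. On
    the right this gives det M = det(X - AB), on the left X^n det M = X^m det(X - BA). *)
Lemma char_poly_mulC m n (A : 'M[F]_(m, n)) (B : 'M[F]_(n, m)) :
  'X^n * char_poly (A *m B) = 'X^m * char_poly (B *m A).
Proof.
rewrite /char_poly /char_poly_mx !map_mxM /=.
set A' := map_mx _ A; set B' := map_mx _ B.
pose M := block_mx ('X%:M : 'M[{poly F}]_m) A' B' 1%:M.
have detl : \det M = \det ('X%:M - A' *m B').
  have /(congr1 determinant) : M *m block_mx 1%:M 0 (- B') 1%:M =
      block_mx ('X%:M - A' *m B') A' 0 1%:M.
    rewrite mulmx_block !mulmx1 !mulmx0 !mul1mx !add0r mulmxN.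
    by rewrite subrr.
  by rewrite det_mulmx det_lblock det_ublock !det1 !mulr1.
have /(congr1 determinant) :  block_mx 1%:M 0 (- B') 'X%:M *m M =
    block_mx 'X%:M A' 0 ('X%:M - B' *m A').
  rewrite mulmx_block !mul1mx !mul0mx !addr0 mulmx1 !mulNmx.
  by rewrite mul_mx_scalar mul_scalar_mx addNr addrC.
by rewrite det_mulmx det_lblock det_ublock det1 !det_scalar detl mul1r.
Qed.

(** Pull the factor c out of X - a - cA; substituting (X - a)/c for X is a ring morphism, so it
    commutes with the determinant. *)
Lemma char_poly_affine n (c a : F) (A : 'M[F]_n) : c != 0 ->
  char_poly (c *: A + a%:M) =
    c ^+ n *: (char_poly A \Po (c^-1 *: ('X - a%:P))).
Proof.
move=> c0; set q := _ *: ('X - _).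
have -> : char_poly A \Po q = \det (q%:M - map_mx polyC A).
  rewrite /char_poly -[LHS]/(comp_poly q _) -det_map_mx; congr (\det _).
  apply/matrixP=> i j; rewrite !mxE; set z := ('X *+ _).
  rewrite /= comp_polyB comp_polyC {}/z.
  by case: (i == j); rewrite ?mulr1n ?mulr0n ?comp_polyX ?comp_poly0.
rewrite -mul_polyC polyC_exp -detZ; congr (\det _).
apply/matrixP=> i j; rewrite !mxE polyCD polyCM mulrBr opprD addrCA addrC.
congr (_ + _); case: (i == j); rewrite ?mulr1n ?mulr0n ?mulr0 ?subr0 //.
by rewrite mul_polyC scalerA divff // scale1r.
Qed.

(** Values may repeat and multiplicities may be 0, so one list remains valid when eigenvalues
    coincide for particular parameters. *)
Definition spectrum_is n (A : 'M[F]_n) (s : seq (F * nat)) : Prop :=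
  (\sum_(xc <- s) xc.2 = n)%N /\
  char_poly A = \prod_(xc <- s) ('X - (xc.1)%:P) ^+ xc.2.

Lemma spectrum_affine n (c a : F) (A : 'M[F]_n) s : c != 0 ->
  spectrum_is A s ->
  spectrum_is (c *: A + a%:M) [seq (c * xc.1 + a, xc.2) | xc <- s].
Proof.
move=> c0 [sz chA]; split; first by rewrite big_map.
(* As [n] is the total multiplicity, [c ^+ n] can be shared out, one [c] to each linear factor. *)
rewrite char_poly_affine // chA big_map /= -sz -mul_polyC.
elim: s {sz chA} => [|[x k] s IHs] /=.
  by rewrite !big_nil expr0 -polyC1 comp_polyC -polyCM mulr1.
rewrite !big_cons /= exprD polyCM comp_polyM mulrACA IHs; congr (_ * _).
rewrite -[_ \Po _]/(comp_poly _ _) !rmorphXn /= -exprMn; congr (_ ^+ k).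
rewrite comp_polyB comp_polyX comp_polyC mulrBr mul_polyC scalerA divff //.
by rewrite scale1r -polyCM polyCD opprD addrA addrAC.
Qed.

(** Cancel X^m in [char_poly_mulC]: the larger product has n - m further zeros. *)
Lemma spectrum_mulC m n (A : 'M[F]_(m, n)) (B : 'M[F]_(n, m)) s : (m <= n)%N ->
  spectrum_is (A *m B) s -> spectrum_is (B *m A) (rcons s (0, (n - m)%N)).
Proof.
move=> le_mn [sz chA]; split; first by rewrite big_rcons /= sz subnKC.
have := char_poly_mulC A B; rewrite -{1}(subnKC le_mn) exprD -mulrA.
move/(mulfI (monic_neq0 (monicXn F m))) => <-.
by rewrite big_rcons /= chA subr0 mulrC.
Qed.

Lemma spectrum_const m (a : F) : (0 < m)%N ->
  spectrum_is (const_mx a : 'M_m) [:: (m%:R * a, 1%N); (0, m.-1)].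
Proof.
move=> m0; rewrite -subn1.
(* A constant matrix is a column times a row; the reversed product is the 1 x 1 matrix ma. *)
have -> : const_mx a = (const_mx 1 : 'cV_m) *m (const_mx a : 'rV_m).
  by apply/matrixP=> i j; rewrite !mxE big_ord1 !mxE mul1r.
apply: (@spectrum_mulC _ _ _ _ [:: (m%:R * a, 1%N)]) => //.
split; first by rewrite big_seq1.
have -> : (const_mx a : 'rV_m) *m const_mx 1 = (m%:R * a)%:M.
  apply/matrixP=> i j; rewrite !mxE [i]ord1 [j]ord1 mulr1n.
  by under eq_bigr do rewrite !mxE mulr1; rewrite sumr_const card_ord mulr_natl.
by rewrite big_seq1 expr1 /char_poly det_mx11 !mxE !mulr1n.
Qed.

End Spectrum.

(** Unlike in [has_spectrum], the list includes the eigenvalue belonging to the degree, so affine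
    maps and blow-ups act uniformly on it. *)
Definition graph_spectrum (T : finType) (V : {set T}) (adj : rel T) (k : nat)
    (s : seq (algC * nat)) : Prop :=
  regular_graph V adj k /\ spectrum_is (adjacency_mx V adj) s.

Lemma graph_spectrum_has_spectrum (T : finType) (V : {set T}) adj k s r c :
  graph_spectrum V adj k ((k%:R : algC, 1%N) :: rcons s (r, c)) ->
  has_spectrum V adj k s r.
Proof.
case=> regV [sz chA]; split=> //; exists c; split.
  by move: sz; rewrite big_cons big_rcons /= addnA.
by rewrite [LHS]chA big_cons big_rcons /= expr1 mulrA.
Qed.

(** * Adding and removing loops *)

Section ReflexiveClosure.
Variables (T : finType) (V : {set T}) (adj : rel T).
Hypothesis adj_irr : {in V, irreflexive adj}.

Let radj := [rel x y | (x == y) || adj x y].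

Lemma card_reflexive_closure :
  {in V, forall x, #|[set y in V | radj x y]| = #|[set y in V | adj x y]|.+1}.
Proof.
move=> x xV; rewrite (cardsD1 x) !inE xV eqxx /= add1n; congr _.+1.
apply: eq_card => y; rewrite !inE (eq_sym x); case: eqVneq => //= ->.
by rewrite adj_irr // andbF.
Qed.

Lemma adjacency_reflexive_closure :
  adjacency_mx V radj = adjacency_mx V adj + 1%:M.
Proof.
apply/matrixP=> i j; rewrite !mxE /= (inj_eq enum_val_inj).
by case: eqVneq => [->|]; rewrite ?adj_irr ?enum_valP ?add0r ?addr0.
Qed.

Lemma graph_spectrum_reflexive_closure k s : graph_spectrum V adj k s ->
  graph_spectrum V radj k.+1 [seq (xc.1 + 1, xc.2) | xc <- s].
Proof.
case=> regV spV; split.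
  by move=> x xV; rewrite card_reflexive_closure // regV.
rewrite adjacency_reflexive_closure -[adjacency_mx V adj]scale1r.
have := spectrum_affine 1 (oner_neq0 _) spV.
by under eq_map do rewrite mul1r.
Qed.

Lemma reflexive_closure_graph_spectrum k s : graph_spectrum V radj k.+1 s ->
  graph_spectrum V adj k [seq (xc.1 - 1, xc.2) | xc <- s].
Proof.
case=> regV spV; split.
  by move=> x xV; apply: succn_inj; rewrite -card_reflexive_closure // regV.
have := spectrum_affine (-1) (oner_neq0 _) spV.
under eq_map do rewrite mul1r.
by rewrite adjacency_reflexive_closure scale1r raddfN /= addrK.
Qed.

End ReflexiveClosure.

(** * Blow-ups of graphs *)

Section BlowUp.
Variables (T U : finType) (V : {set T}) (W : {set U}) (pi : T -> U) (q : nat).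
Hypothesis piVW : {in V, forall v, pi v \in W}.
Hypothesis card_fiber : {in W, forall w, #|[set v in V | pi v == w]| = q}.

Lemma card_blowup (Q : pred U) :
  #|[set v in V | Q (pi v)]| = (q * #|[set w in W | Q w]|)%N.
Proof.
rewrite mulnC -sum_nat_const -sum1_card.
rewrite (partition_big pi [in [set w in W | Q w]]) /=; last first.
  by move=> v; rewrite !inE => /andP[/piVW-> ->].
apply: eq_bigr => w; rewrite inE => /andP[/card_fiber<- Qw].
rewrite -sum1_card; apply: eq_bigl => v; rewrite !inE.
by case: eqVneq => [->|]; rewrite ?Qw ?andbT ?andbF.
Qed.

Lemma card_blowup_total : #|V| = (q * #|W|)%N.
Proof.
have := card_blowup predT; rewrite !setIdE.
by congr (_ = (_ * _)%N); apply: eq_card => x; rewrite !inE andbT.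
Qed.

(* With P the incidence matrix of the graph of pi, the adjacency matrix upstairs
   is P A P^T, while P^T P is the scalar q. *)
Lemma graph_spectrum_blowup adj adj' k s : (0 < q)%N ->
  {in V &, forall v v', adj v v' = adj' (pi v) (pi v')} ->
  graph_spectrum W adj' k s ->
  graph_spectrum V adj (q * k)
    (rcons [seq (q%:R * xc.1, xc.2) | xc <- s] (0, (#|V| - #|W|)%N)).
Proof.
move=> q0 adjE [regW spW]; split.
  move=> x xV; rewrite -(regW _ (piVW xV)) -card_blowup.
  apply: eq_card => y; rewrite !inE.
  by case: (boolP (y \in V)) => //= yV; rewrite adjE.
pose P : 'M[algC]_(#|V|, #|W|) :=
  \matrix_(i, j) (pi (enum_val i) == enum_val j)%:R.
(* Row i of P has its only 1 in the column of the image of vertex i, so P M copies that row of M. *)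
have PM (M : 'M_#|W|) i j l : enum_val j = pi (enum_val i) ->
    (P *m M) i l = M j l.
  move=> ej; rewrite mxE (bigD1 j) //= big1 ?addr0.
    by rewrite mxE ej eqxx mul1r.
  move=> j' nj.
  by rewrite mxE -ej (inj_eq enum_val_inj) eq_sym (negPf nj) mul0r.
have pij (i : 'I_#|V|) : exists j : 'I_#|W|, enum_val j = pi (enum_val i).
  have pW : pi (enum_val i) \in W by apply/piVW/enum_valP.
  by exists (enum_rank_in pW (pi (enum_val i))); rewrite enum_rankK_in.
have -> : adjacency_mx V adj = P *m (adjacency_mx W adj' *m P^T).
  apply/matrixP=> i i'; have [j ej] := pij i; have [j' ej'] := pij i'.
  rewrite mulmxA [RHS]mxE (bigD1 j') //= big1 ?addr0 => [|l nl].
    rewrite [LHS]mxE (PM _ i j) // !mxE ej ej' eqxx mulr1.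
    by rewrite adjE // enum_valP.
  by rewrite !mxE -ej' (inj_eq enum_val_inj) eq_sym (negPf nl) mulr0.
(* Reversing P (A P^T) gives A (P^T P) = qA, at the cost of [#|V| - #|W|] zeros. *)
apply: spectrum_mulC.
  by rewrite card_blowup_total leq_pmull.
(* Distinct columns of P are supported on disjoint fibres, each of size q. *)
rewrite -mulmxA; have -> : P^T *m P = q%:R%:M.
  apply/matrixP=> j l; rewrite !mxE.
  under eq_bigr do rewrite !mxE -natrM mulnb.
  rewrite -natr_sum -(big_enum_val (fun v => nat_of_bool
    ((pi v == enum_val j) && (pi v == enum_val l)))).
  rewrite -big_mkcondr /= sum1dep_card.
  case: eqVneq => [->|nejl].
    rewrite mulr1n -(card_fiber (enum_valP l)); congr (_%:R).
    by apply: eq_card => v; rewrite !inE andbb.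
  rewrite eq_card0 // => v; rewrite !inE.
  apply/negbTE/negP=> /and3P[_ /eqP-> /eqP/enum_val_inj/eqP].
  by rewrite (negPf nejl).
rewrite mul_mx_scalar.
have q'0 : q%:R != 0 :> algC by rewrite pnatr_eq0 -lt0n.
have := spectrum_affine 0 q'0 spW; rewrite raddf0 addr0.
by under eq_map do rewrite addr0.
Qed.

End BlowUp.

(** * Extensions as maps between classes of 3-transpositions *)

Section ThreeTranspositionExtensions.
Local Open Scope group_scope.

Lemma three_transposition_mulgg (gT : finGroupType) (G : {group gT}) D :
  three_transposition_group G D -> {in D, forall d, d * d = 1}.
Proof. by case=> _ _ ord2 _ d /ord2 d2; rewrite -expg2 -d2 expg_order. Qed.

Lemma diagram_irreflexive (gT : finGroupType) (G : {group gT}) D :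
  three_transposition_group G D -> {in D, irreflexive (@diagram gT)}.
Proof.
by move=> GD d dD; rewrite /diagram (three_transposition_mulgg GD dD) order1.
Qed.

Section ExtensionMap.
Variables (p j : nat) (gT hT : finGroupType).
Variables (G : {group gT}) (D : {set gT}) (E : {set hT}).
Hypothesis GD : three_transposition_group G D.
Variable pi : gT -> hT.

(** This is what the diagram sees of the type: a map of vertex sets, with the homomorphism reduced
    to conditions on orders of products. *)
Record extension_map : Prop := ExtensionMap {
  extension_map_in : {in D, forall d, pi d \in E};
  extension_map_fiber :
    {in E, forall e, #|[set d in D | pi d == e]| = (p ^ j)%N};
  extension_map_ker : {in D &, forall d e, pi d = pi e -> p.-elt (d * e)};
  extension_map_order : {in D &, forall d e, (#[pi d * pi e] %| #[d * e])%N}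
}.

Hypothesis piP : extension_map.

(** The order below divides that above, which is at most 3, and is not 1; a divisor of 2 or 3 other
    than 1 is the number itself. *)
Lemma extension_map_diagram :
  {in D &, forall d e, pi d <> pi e -> diagram d e = diagram (pi d) (pi e)}.
Proof.
move=> d e dD eD neq; rewrite /diagram.
have ordde : #[d * e] \in [:: 1%N; 2%N; 3%N] by case: GD => _ _ _; apply.
have := extension_map_order piP dD eD; have := order_gt0 (pi d * pi e).
(* The order of this square divides that of e e = 1. *)
have ee : pi e * pi e = 1.
  apply/eqP; rewrite -order_eq1 -dvdn1 -(order1 gT).
  by rewrite -(three_transposition_mulgg GD eD) (extension_map_order piP).
have : #[pi d * pi e] != 1%N.
  rewrite order_eq1; apply/eqP=> de1; apply: neq.
  by rewrite -[pi d]mulg1 -ee mulgA de1 mul1g.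
move: ordde; rewrite !inE; case/or3P=> /eqP->;
  by case: #[pi d * pi e] => [|[|[|[|n]]]] // _ _ /dvdn_leq; apply.
Qed.

(** For d other than e, the order of de is a power of p and equals 2 or 3, hence it is p. *)
Lemma extension_map_diagram_fiber :
  {in D &, forall d e, pi d = pi e ->
     diagram d e = (p == 3%N) && (d != e)}.
Proof.
move=> d e dD eD pi_de; have := extension_map_ker piP dD eD pi_de.
case: (eqVneq d e) => [-> _ | neq_de].
  by rewrite /= andbF (diagram_irreflexive GD).
have ordde : #[d * e] \in [:: 1%N; 2%N; 3%N] by case: GD => _ _ _; apply.
have: #[d * e] != 1%N.
  rewrite order_eq1; apply: contraNneq neq_de => de1.
  have ee := three_transposition_mulgg GD eD.
  by rewrite -[d]mulg1 -ee mulgA de1 mul1g.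
rewrite /p_elt /diagram andbT; move: ordde; rewrite !inE.
by case/or3P=> /eqP-> // _; rewrite pnatE // inE => /eqP <-.
Qed.

End ExtensionMap.

(** The map sends d to the image of dN. Its fibre through d is the intersection of D with dN, and dN
    = eN puts de in the p-group N because e is an involution. *)
Lemma has_ext_type_map p j (gT hT : finGroupType) (G : {group gT}) D
    (H : {group hT}) E :
  three_transposition_group G D -> has_ext_type p j G D H E ->
  exists pi : gT -> hT, extension_map p j D E pi.
Proof.
move=> GD [N [nNG pN cardD [f [isof fE]]]].
have sDG : {subset D <= G}.
  by case: GD => <- _ _ _; apply/subsetP/subset_gen.
have nN : {subset G <= 'N(N)} by apply/subsetP/normal_norm.
have [injf _] := isomP isof.
pose pi d := f (coset N d).
have piE : {in D &, forall d e, pi d = pi e -> coset N d = coset N e}.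
  move=> d e dD eD; apply: (injmP injf); apply: mem_quotient; exact: sDG.
exists pi; split.
- move=> d dD; rewrite -fE; apply: mem_morphim.
    exact/mem_quotient/sDG.
  by apply: mem_morphim => //; apply/nN/sDG.
- move=> e; rewrite -fE => /morphimP[_ _ /morphimP[d _ dD ->] ->].
  rewrite -(cardD _ dD); apply: eq_card => x; rewrite !inE.
  case xD: (x \in D) => //=.
  have xN := nN _ (sDG _ xD); have dN := nN _ (sDG _ dD).
  rewrite -[f _]/(pi d) -norm_rlcoset //.
  by apply/eqP/(rcoset_kercosetP xN dN) => [/piE->|] //; rewrite /pi => ->.
- move=> d e dD eD /piE E'; apply: (mem_p_elt pN).
  have dN := nN _ (sDG _ dD); have eN := nN _ (sDG _ eD).
  apply: coset_idr; first exact: groupM.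
  rewrite morphM //= E' // -morphM //=.
  by rewrite (three_transposition_mulgg GD) // morph1.
- move=> d e dD eD.
  have dN := nN _ (sDG _ dD); have eN := nN _ (sDG _ eD).
  have dG := mem_quotient N (sDG _ dD); have eG := mem_quotient N (sDG _ eD).
  rewrite /pi -morphM //; apply: dvdn_trans (morph_order _ _) _.
    exact: groupM.
  by rewrite -morphM //; apply: morph_order; apply: groupM.
Qed.

End ThreeTranspositionExtensions.

(** * Transpositions and the triangular graph *)

Section Transpositions.
Local Open Scope group_scope.
Variable m : nat.
Implicit Types (x y : 'I_m) (s t : 'S_m).

Lemma transpositionsP t :
  reflect (exists2 xy : 'I_m * 'I_m, xy.1 != xy.2 & t = tperm xy.1 xy.2)
          (t \in transpositions m).
Proof.
apply: (iffP imset2P) => [[x y _] | [[x y] /= nxy ->]].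
  by rewrite inE => nxy ->; exists (x, y).
by exists x y; rewrite ?inE.
Qed.

Lemma transposition_moved t x :
  t \in transpositions m -> t x != x -> t = tperm x (t x).
Proof.
case/transpositionsP=> -[y z] /= nyz ->.
case: tpermP => [->|->|]; rewrite ?eqxx //.
by rewrite tpermC.
Qed.

Lemma sum_moved x y (F : 'I_m -> nat) : x != y ->
  (\sum_z (tperm x y z != z) * F z = F x + F y)%N.
Proof.
move=> nxy; have nyx : y != x by rewrite eq_sym.
rewrite (bigD1 x) //= (bigD1 y) //= big1 ?addn0 => [|z /andP[zx zy]].
  by rewrite tpermL tpermR nxy nyx !mul1n.
by rewrite tpermD ?eqxx // eq_sym.
Qed.

Lemma card_transpositions_moving x :
  (\sum_(t in transpositions m) (t x != x) = m.-1)%N.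
Proof.
have -> : m.-1 = #|[set~ x]| by rewrite cardsC1 card_ord.
(* Sending y to (x y) is a bijection from the other points to the transpositions moving x. *)
have injt : injective (tperm x).
  by move=> y z /(congr1 (fun t : 'S_m => t x)); rewrite !tpermL.
rewrite -(card_imset _ injt) -big_mkcondr sum1dep_card; apply: eq_card => t.
rewrite !inE; apply/andP/imsetP => [[tT tx] | [y]].
  by exists (t x); rewrite ?inE // -transposition_moved.
rewrite !inE => yx ->; rewrite tpermL; split=> //.
by apply/transpositionsP; exists (x, y); rewrite //= eq_sym.
Qed.

(** Double counting of the pairs of a transposition and a point moved by it. *)
Lemma card_transpositions : (2 * #|transpositions m| = m * m.-1)%N.
Proof.
rewrite mulnC -sum_nat_const -[X in (X * _)%N]card_ord -sum_nat_const.
transitivity (\sum_(x < m) \sum_(t in transpositions m) (t x != x))%N;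
  last first.
  by apply: eq_bigr => x _; apply: card_transpositions_moving.
rewrite exchange_big /=; apply: eq_bigr => _ /transpositionsP[[x y] nxy ->] /=.
rewrite -[LHS](sum_moved (fun=> 1%N) nxy).
by apply: eq_bigr => z _; rewrite muln1.
Qed.

Lemma tperm_adjacent x y z : x != y -> y != z -> z != x ->
  diagram (tperm x y) (tperm x z).
Proof.
move=> nxy nyz nzx; set t := tperm x y; set s := tperm x z.
have t2 : t * t = 1 by apply: tperm2.
have s2 : s * s = 1 by apply: tperm2.
(* Both sides are conjugates equal to (y z); with t and s involutions, the braid relation gives
   (ts)^3 = 1. *)
have braid : t * s * t = s * t * s.
  have -> : t * s * t = s ^ t by rewrite conjgE tpermV mulgA.
  have -> : s * t * s = t ^ s by rewrite conjgE tpermV mulgA.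
  by rewrite !tpermJ !tpermL !tpermD // 1?eq_sym // tpermC.
have : (#[t * s] %| 3)%N.
  rewrite order_dvdn !expgS expg0 mulg1 !mulgA braid -(mulgA (s * t)) s2.
  by rewrite mulg1 -(mulgA s) t2 mulg1 s2.
rewrite /diagram dvdn_divisors // !inE => /orP[|//].
rewrite order_eq1; apply: contraTT => _; apply: contraNneq nyz => ts1.
have : t = s by rewrite -[t]mulg1 -s2 mulgA ts1 mul1g.
by move/(congr1 (fun u : 'S_m => u x)); rewrite !tpermL => ->.
Qed.

(** This is B^T B = A + 2 entry by entry. If s moves neither x nor y it commutes with (x y), if it
    moves one of them the two are adjacent, and if it moves both they are equal. *)
Lemma diagram_transpositions x y s : x != y -> s \in transpositions m ->
  ((s x != x) + (s y != y) = diagram (tperm x y) s + 2 * (tperm x y == s))%N.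
Proof.
move=> nxy sT; set t := tperm x y.
have [sx | sx] := eqVneq (s x) x; have [sy | sy] := eqVneq (s y) y.
- have st : t ^ s = t by rewrite tpermJ sx sy.
  have /negPf-> : t != s by apply: contraNneq nxy => ts; rewrite -sx -ts tpermL.
  have c : commute t s by apply/commgP/conjg_fixP.
  have s2 : s * s = 1.
    by case/transpositionsP: sT => -[a b] _ ->; apply: tperm2.
  suff: (#[t * s] %| 2)%N by rewrite /diagram; case: eqP => // ->.
  by rewrite order_dvdn expgMn // !expg2 tperm2 s2 mulg1.
- have ns : t != s.
    by apply: contraNneq nxy => ts; rewrite -sx -ts tpermL.
  rewrite (negPf ns) /t tpermC (transposition_moved sT sy) tperm_adjacent //.
    by rewrite eq_sym.
  by rewrite -{1}sx (inj_eq perm_inj).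
- have ns : t != s.
    by apply: contraNneq nxy => ts; rewrite -sy -ts tpermR.
  rewrite (negPf ns) /t (transposition_moved sT sx) tperm_adjacent //.
  by rewrite -{1}sy (inj_eq perm_inj) eq_sym.
- have -> : s = t.
    rewrite /t (transposition_moved sT sx); congr tperm.
    move: sy; rewrite {1}(transposition_moved sT sx).
    case: tpermP => [yx|->|_ _]; rewrite ?eqxx //.
    by rewrite yx eqxx in nxy.
  by rewrite eqxx /diagram tperm2 order1.
Qed.

End Transpositions.

Lemma graph_spectrum_transpositions (m : nat) : (3 <= m)%N ->
  graph_spectrum (transpositions m) (@diagram 'S_m) (2 * (m - 2))
    [:: (2 * (m%:R - 2), 1%N); (m%:R - 4, (m - 1)%N);
        (-2, (#|transpositions m| - m)%N)].
Proof.
move=> m3; set V := transpositions m; split.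
  move=> t tV; have [[x y] /= nxy et] := transpositionsP _ tV.
  (* Summed over s, the entrywise identity reads 2(m - 1) = degree + 2. *)
  have : (\sum_(s in V) ((s x != x) + (s y != y)) =
          \sum_(s in V) (diagram t s + 2 * (t == s)))%N.
    by apply: eq_bigr => s sV; rewrite et diagram_transpositions.
  have sum1 : (\sum_(s in V) 2 * (t == s) = 2)%N.
    rewrite (bigD1 t tV) /= eqxx big1 // => s /andP[_ /negPf].
    by rewrite eq_sym => ->.
  rewrite [LHS]big_split [RHS]big_split /= !card_transpositions_moving sum1.
  rewrite -big_mkcondr sum1dep_card => degE.
  by apply: (@addIn 2); rewrite -degE; lia.
pose B : 'M[algC]_(m, #|V|) := \matrix_(x, j) ((enum_val j : 'S_m) x != x)%:R.
have sumV x (Q : pred 'S_m) : \sum_(j < #|V|) B x j * (Q (enum_val j))%:R =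
    (\sum_(s in V) ((s x != x) && Q s))%:R.
  rewrite (big_enum_val (fun s : 'S_m => ((s x != x) && Q s) : nat)) natr_sum.
  by apply: eq_bigr => j _; rewrite mxE -natrM mulnb.
(* Entry (x, y) counts the transpositions moving both points: m - 1 on the diagonal, 1 off it. The
   factor [1 *:] gives the shape required by [spectrum_affine]. *)
have BBt : B *m B^T = 1 *: const_mx 1 + (m%:R - 2)%:M.
  apply/matrixP=> x y; rewrite mxE scale1r.
  transitivity ((\sum_(s in V) ((s x != x) && (s y != y)))%N%:R : algC).
    rewrite -(sumV x (fun s => s y != y)).
    by apply: eq_bigr => j _; rewrite !mxE.
  rewrite !mxE; case: eqVneq => [->|nxy].
    under eq_bigr do rewrite andbb.
    rewrite card_transpositions_moving mulr1n -subn1 natrB; first by ring.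
    by rewrite ltnW // ltnW.
  rewrite addr0 (bigD1 (tperm x y)) /=; last first.
    by apply/transpositionsP; exists (x, y).
  rewrite tpermL tpermR eq_sym nxy big1 // => s /andP[sV ns].
  apply/eqP; rewrite eqb0; apply: contraNN ns => /andP[sx sy].
  have := diagram_transpositions nxy sV; rewrite sx sy eq_sym.
  by case: eqP => // _; case: diagram.
have BtB : adjacency_mx V (@diagram 'S_m) = 1 *: (B^T *m B) + (-2)%:M.
  rewrite scale1r; apply/matrixP=> i j; apply/esym/eqP.
  have iV : enum_val i \in V by apply: enum_valP.
  have jV : enum_val j \in V by apply: enum_valP.
  have [[x y] /= nxy et] := transpositionsP _ iV.
  have -> (M : 'M[algC]_#|V|) : (M + (-2)%:M) i j = M i j - (2 * (i == j))%:R.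
    by rewrite !mxE; case: eqP; rewrite ?mulr1n // mulr0n oppr0.
  rewrite subr_eq [in X in _ == X]mxE -natrD -(inj_eq enum_val_inj) et.
  rewrite -diagram_transpositions // 
    -(sum_moved (fun z => ((enum_val j : 'S_m) z != z) : nat) nxy).
  rewrite -et mxE natr_sum.
  by apply/eqP/eq_bigr => z _; rewrite !mxE natrM.
(* With at least 3 points there are at least as many pairs as points, as [spectrum_mulC]
   requires. *)
have mV : (m <= #|V|)%N.
  by have := card_transpositions m; rewrite -/V; nia.
(* From m and 0 for J, the shift by m - 2 gives 2m - 2 and m - 2; reversing the product adds zeros,
   and subtracting 2 gives 2m - 4, m - 4 and -2. *)
have := spectrum_const (1 : algC) (ltnW (ltnW m3)).
move/(spectrum_affine (m%:R - 2) (oner_neq0 _)); rewrite -BBt.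
move/(spectrum_mulC mV)/(spectrum_affine (-2) (oner_neq0 _)); rewrite -BtB /=.
rewrite subn1; congr (spectrum_is _ [:: (_, _); (_, _); (_, _)]); ring.
Qed.

(** * Effect of extensions on the spectrum *)

Section ExtensionSpectrum.
Variables (j : nat) (gT hT : finGroupType).
Variables (G : {group gT}) (D : {set gT}) (E : {set hT}) (pi : gT -> hT).
Hypothesis GD : three_transposition_group G D.
Hypothesis irrE : {in E, irreflexive (@diagram hT)}.
Implicit Types (k : nat) (s : seq (algC * nat)).

(** For p = 2 a fibre has no edges, matching the absence of loops in the diagram below, so adjacency
    is pulled back inside fibres as well. *)
Lemma graph_spectrum_ext2 k s : extension_map 2 j D E pi ->
  graph_spectrum E (@diagram hT) k s ->
  graph_spectrum D (@diagram gT) (2 ^ j * k)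
    (rcons [seq ((2 ^ j)%:R * xc.1, xc.2) | xc <- s] (0, (#|D| - #|E|)%N)).
Proof.
move=> piP; apply: (graph_spectrum_blowup (extension_map_in piP)
  (extension_map_fiber piP)); first by rewrite expn_gt0.
move=> d e dD eD; case: (eqVneq (pi d) (pi e)) => [pi_de | /eqP neq].
  rewrite (extension_map_diagram_fiber GD piP) // pi_de irrE //.
  exact: (extension_map_in piP).
exact: (extension_map_diagram GD piP).
Qed.

(* Here the fibres are cliques, so it is the reflexive closure of the diagram
   which is a blow-up. *)
Lemma graph_spectrum_ext3 k s : extension_map 3 j D E pi ->
  graph_spectrum E (@diagram hT) k s ->
  graph_spectrum D (@diagram gT) (3 ^ j * k.+1 - 1)
    [seq (xc.1 - 1, xc.2) | xc <-
      rcons [seq ((3 ^ j)%:R * xc.1, xc.2) |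
               xc <- [seq (xc.1 + 1, xc.2) | xc <- s]] (0, (#|D| - #|E|)%N)].
Proof.
move=> piP spE; apply: reflexive_closure_graph_spectrum.
  exact: diagram_irreflexive GD.
rewrite subn1 prednK ?muln_gt0 ?expn_gt0 //.
apply: (graph_spectrum_blowup (extension_map_in piP) (extension_map_fiber piP)
  _ _ (graph_spectrum_reflexive_closure irrE spE)); first by rewrite expn_gt0.
move=> d e dD eD /=; case: (eqVneq (pi d) (pi e)) => [pi_de | neq] /=.
  by rewrite (extension_map_diagram_fiber GD piP) //; case: (eqVneq d e).
rewrite -(extension_map_diagram GD piP) //; last exact/eqP.
by case: (eqVneq d e) => // de; rewrite de eqxx in neq.
Qed.

End ExtensionSpectrum.

(** * The two extensions combined over Sym(m) *)

Theorem proposition6p6 (m h : nat) (hm : (4 <= m)%N)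
    (gT : finGroupType) (G : {group gT}) (D : {set gT})
    (GD : three_transposition_group G D)
    (hT : finGroupType) (H : {group hT}) (E : {set hT})
    (HE : three_transposition_group H E)
    (typeH : has_ext_type 3 1 H E [set: 'S_m]%G (transpositions m))
    (typeG : has_ext_type 2 (2 * h) G D H E) :
  #|D|%:R = 3 * 2 ^ ((2 * h)%:Z - 1) * m%:R * (m%:R - 1) :> rat /\
  has_spectrum D (@diagram gT) (4 ^ h * (6 * m - 10))
    [:: (4 ^+ h * (3 * m%:R - 10), (m - 1)%N);
        (- 4 ^+ h.+1, (m * (m - 3) %/ 2)%N);
        (- 4 ^+ h, (m * (m - 1))%N)]
    0.
Proof.
have [f fP] := has_ext_type_map GD typeG.
have [g gP] := has_ext_type_map HE typeH.
have cardD := card_blowup_total (extension_map_in fP) (extension_map_fiber fP).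
have cardE := card_blowup_total (extension_map_in gP) (extension_map_fiber gP).
have cardT := card_transpositions m.
split.
  (* The size is computed in the rationals, since the exponent 2h - 1 is negative for h = 0. *)
  have := congr1 (fun n => n%:R : rat) cardT.
  rewrite -subn1 !natrM natrB; last by lia.
  move=> cardTr; rewrite expfzDr // -exprnP exprN1 cardD cardE expn1.
  rewrite !natrM natrX.
  by rewrite -[RHS]mulrA -cardTr; field.
have irrT : {in transpositions m, irreflexive (@diagram 'S_m)}.
  by move=> _ /transpositionsP[xy _ ->]; rewrite /diagram tperm2 order1.
have spT := graph_spectrum_transpositions (ltnW hm).
(* An eigenvalue t becomes 3(t + 1) - 1 = 3t + 2, so 2m - 4, m - 4, -2 turn into 6m - 10, 3m - 10,
   -4, and -1 is new. The next extension multiplies all of them by 4^h and adds zeros. *)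
have spE := graph_spectrum_ext3 HE irrT gP spT.
have spD := graph_spectrum_ext2 GD (diagram_irreflexive HE) fP spE.
(* The starred multiplicity is the number of zeros added by the 2-extension. *)
apply: (@graph_spectrum_has_spectrum _ _ _ _ _ _ (#|D| - #|E|)%N).
have q4 : (4 ^ h)%:R = 4 ^+ h :> algC by rewrite natrX.
have e4 : (2 ^ (2 * h) = 4 ^ h)%N by rewrite expnM.
move: spD; rewrite /= e4 q4 expn1.
rewrite (_ : #|transpositions m| - m = m * (m - 3) %/ 2)%N; last first.
  rewrite -[LHS](@mulKn _ 2) // mulnBr cardT (mulnC 2) -mulnBr.
  by congr (_ * _ %/ _)%N; lia.
(* The eigenvalue -1 of E has multiplicity 3|T| - |T| = 2|T|, where T is the set of
   transpositions. *)
rewrite (_ : #|E| - #|transpositions m| = m * (m - 1))%N; last first.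
  by rewrite cardE expn1 -[X in (_ - X)%N]mul1n -mulnBl cardT subn1.
congr (graph_spectrum _ _ _ [:: (_, _); (_, _); (_, _); (_, _); _]).
- by congr muln; lia.
- rewrite natrM q4 natrB ?natrM; last by lia.
  ring.
- ring.
- rewrite exprS; ring.
- ring.
Qed.
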